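(* Let $V$ be a finite set with $\#V=n$, let $k,l$ be positive integers, and let $f,g:\mathcal P(V)^{k+l}\to\mathbb R$ with $g>0$ on tuples of nonempty sets. Let $f^M,g^M$ be the piecewise multilinear extensions of $f,g$. Suppose $$\min_{B\in(\mathcal P(V)\setminus\{\varnothing\})^l}\ \max_{A\in(\mathcal P(V)\setminus\{\varnothing\})^k}\frac{f(A,B)}{g(A,B)}=\max_{A\in(\mathcal P(V)\setminus\{\varnothing\})^k}\ \min_{B\in(\mathcal P(V)\setminus\{\varnothing\})^l}\frac{f(A,B)}{g(A,B)}.\qquad(\ast)$$ Then $$\inf_{y\in(0,\infty)^{ln}}\ \sup_{x\in(0,\infty)^{kn}}\frac{f^M(x,y)}{g^M(x,y)}=\sup_{x\in(0,\infty)^{kn}}\ \inf_{y\in(0,\infty)^{ln}}\frac{f^M(x,y)}{g^M(x,y)},$$ and this common value coincides with that of $(\ast)$. Moreover, $(A^*,B^* )$ is a saddle point of $f/g$ if and only if $(\mathbf 1_{A^*},\mathbf 1_{B^*})$ is a saddle point of $f^M/g^M$.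
   Context: Piecewise multilinear extension: for $h:\mathcal P(V)^N\to\mathbb R$ (with the convention $h=0$ if some argument is $\varnothing$), define $h^M:(\mathbb R^n)^N\to\mathbb R$ by $$h^M(x^1,\dots,x^N)=\sum_{i_1,\dots,i_N=0}^{n-1}\ \prod_{s=1}^N\big(x^s_{(i_s+1)}-x^s_{(i_s)}\big)\,h\big(V^{(i_1)}(x^1),\dots,V^{(i_N)}(x^N)\big),$$ where $x^s_{(1)}\le\dots\le x^s_{(n)}$ is the non-decreasing rearrangement of the entries of $x^s$, $x^s_{(0)}:=0$, $V^{(0)}(x^s):=V$ and $V^{(i)}(x^s):=\{j\in V:x^s_j>x^s_{(i)}\}$ for $i\ge1$. For $A=(A_1,\dots,A_k)$, $\mathbf 1_A=(\mathbf 1_{A_1},\dots,\mathbf 1_{A_k})\in(\mathbb R^n)^k$ (indicator vectors). Saddle points (maximizing in the first block, minimizing in the second): $(A^*,B^* )$ (with all components nonempty) is a saddle point of $f/g$ if $\frac{f(A,B^* )}{g(A,B^* )}\le\frac{f(A^*,B^* )}{g(A^*,B^* )}\le\frac{f(A^*,B)}{g(A^*,B)}$ for all $A,B$ with nonempty components; $(\mathbf 1_{A^*},\mathbf 1_{B^*})$ is a saddle point of $f^M/g^M$ if $\frac{f^M(x,\mathbf 1_{B^*})}{g^M(x,\mathbf 1_{B^*})}\le\frac{f^M(\mathbf 1_{A^*},\mathbf 1_{B^*})}{g^M(\mathbf 1_{A^*},\mathbf 1_{B^*})}\le\frac{f^M(\mathbf 1_{A^*},y)}{g^M(\mathbf 1_{A^*},y)}$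 for all $x\in(0,\infty)^{kn}$, $y\in(0,\infty)^{ln}$. *)

(* Defs.v *)
From mathcomp Require Import all_boot all_order all_algebra.
From mathcomp Require Import reals.

Set Implicit Arguments.
Unset Strict Implicit.
Unset Printing Implicit Defensive.

Import Order.TTheory GRing.Theory Num.Theory.

Local Open Scope ring_scope.

Section Defs.
Context {R : realType} {V : finType}.

Definition nonempties {N : nat} (A : N.-tuple {set V}) : bool :=
  [forall s, tnth A s != set0].

(* For 1 <= i <= #|V| the head 0 shifts the sorted entries so that index i is
   the i-th smallest one; index 0 gives the conventional value 0. *)
Definition order_stat (x : {ffun V -> R}) (i : nat) : R :=
  nth 0 (0 :: sort <=%R [seq x j | j <- enum V]) i.

Definition upper_level (x : {ffun V -> R}) (i : nat) : {set V} :=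
  if i is 0 then [set: V] else [set j | order_stat x i < x j].

(* [nonempties] implements the convention that h vanishes as soon as one of
   its arguments is empty. *)
Definition multilinear_ext {N : nat} (h : N.-tuple {set V} -> R)
    (x : N.-tuple {ffun V -> R}) : R :=
  \sum_(i : {ffun 'I_N -> 'I_#|V|})
    (\prod_(s < N) (order_stat (tnth x s) (i s).+1
                    - order_stat (tnth x s) (i s))) *
    (let A := [tuple upper_level (tnth x s) (i s) | s < N] in
     if nonempties A then h A else 0).

Definition indicator (A : {set V}) : {ffun V -> R} :=
  [ffun j => (j \in A)%:R].

Definition indicators {N : nat} (A : N.-tuple {set V}) :
  N.-tuple {ffun V -> R} := [tuple indicator (tnth A s) | s < N].

Definition pos_vectors {N : nat} (x : N.-tuple {ffun V -> R}) : Prop :=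
  forall (s : 'I_N) (j : V), 0 < tnth x s j.

End Defs.

Section Saddle.
Context {R : realType} {T : Type} {k l : nat}.

Definition quotient (f g : (k + l).-tuple T -> R)
    (a : k.-tuple T) (b : l.-tuple T) : R :=
  f (cat_tuple a b) / g (cat_tuple a b).

(* The competitors range over P and Q, to which a and b need not belong:
   indicator vectors are in general not in the open positive orthant. *)
Definition saddle_point (P : k.-tuple T -> Prop) (Q : l.-tuple T -> Prop)
    (f g : (k + l).-tuple T -> R) (a : k.-tuple T) (b : l.-tuple T) : Prop :=
  (forall a', P a' -> quotient f g a' b <= quotient f g a b) /\
  (forall b', Q b' -> quotient f g a b <= quotient f g a b').

End Saddle.

(* Main.v *)
Require Import Defs.
From mathcomp Require Import all_boot all_order all_algebra.
From mathcomp Require Import all_classical all_reals all_analysis.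

Set Implicit Arguments.
Unset Strict Implicit.
Unset Printing Implicit Defensive.

Import Order.TTheory GRing.Theory Num.Theory.
Import numFieldNormedType.Exports.

Local Open Scope classical_set_scope.
Local Open Scope ring_scope.

(** A vector x with nonnegative entries is a stack of layers: between two
    consecutive order statistics lies a layer whose level set is a subset of V
    and whose thickness is the difference of the two. Giving each set the
    thickness of its layers as weight ([level_weight]), the extension of h at
    (x^1, ..., x^N) is the sum of h over tuples of nonempty sets against the
    product of these weights ([multilinear_extE]). So the extension is a
    weighted sum with nonnegative weights, linear in h, and for a concatenation
    it can be computed one block at a time, in either order
    ([multilinear_ext_cat], [multilinear_ext_catC]).

    Since g is positive, comparing f^M/g^M with a constant c amounts to finding
    the sign of (f - c g)^M, a weighted sum of values of f - c g. Two facts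
    about the weights then suffice. The indicator vector of A has the single
    layer A, so the extension at indicator vectors is h itself
    ([multilinear_ext_indicators]). Adding a constant e to all entries only
    thickens the layer of V by e ([level_weight_raise]), so at the positive
    vectors 1_A + e the weights are polynomials in e that concentrate on A as e
    tends to 0, and a strict inequality at A survives for some positive vector
    ([multilinear_ext_raised_gt0]).

    By finiteness the min-max equality gives a saddle point (A, B) of f/g, of
    value c ([bigmin_bigmax_saddle]). Playing 1_A + e guarantees more than
    c - eps against every positive y ([lt_quotient_ext]), and playing 1_B + e
    guarantees less than c + eps ([quotient_ext_lt]), so
    c <= sup inf <= inf sup <= c, the middle inequality being weak duality. For
    the saddle points, a bound on f/g against a fixed tuple of sets is
    equivalent to the same bound on f^M/g^M against its indicator vectors
    ([quotient_le_indicatorsr], [quotient_ge_indicatorsl]): averaging gives one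
    direction, the perturbation 1_A + e the other. *)

(** * Order statistics and level sets *)

Section LevelWeight.
Context {R : realType} {V : finType}.
Implicit Types (x : {ffun V -> R}) (A C : {set V}).

Definition level_weight x C : R :=
  \sum_(i < #|V| | upper_level x i == C)
    (order_stat x i.+1 - order_stat x i).

Definition raise_entries x (e : R) : {ffun V -> R} := [ffun j => x j + e].

Lemma size_sort_values x : size (sort <=%R [seq x j | j <- enum V]) = #|V|.
Proof. by rewrite size_sort size_map cardE. Qed.

Lemma order_stat_mem x i : (i < #|V|)%N -> exists j, order_stat x i.+1 = x j.
Proof.
move=> iV; have : order_stat x i.+1 \in sort <=%R [seq x j | j <- enum V].
  by apply: mem_nth; rewrite size_sort_values.
by rewrite mem_sort => /mapP[j _ ->]; exists j.
Qed.

Lemma order_stat_step_ge0 x i : (forall j, 0 <= x j) -> (i < #|V|)%N ->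
  order_stat x i <= order_stat x i.+1.
Proof.
move=> x_ge0; case: i => [|i] iV.
  by have [j ->] := order_stat_mem x iV; exact: x_ge0.
rewrite /order_stat /= (sorted_leq_nth le_trans) ?inE ?size_sort_values //.
- by apply: sort_sorted; exact: le_total.
- exact: ltnW.
Qed.

Lemma level_weight_ge0 x C : (forall j, 0 <= x j) -> 0 <= level_weight x C.
Proof.
by move=> x_ge0; apply: sumr_ge0 => i _; rewrite subr_ge0 order_stat_step_ge0.
Qed.

(** The bottom layer of a positive vector, between height 0 and its smallest
    entry, has the whole of V as its level set. *)
Lemma level_weightT_gt0 x : (0 < #|V|)%N -> (forall j, 0 < x j) ->
  0 < level_weight x [set: V]%SET.
Proof.
move=> V_gt0 x_gt0; rewrite /level_weight (bigD1 (Ordinal V_gt0)) //=.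
apply: ltr_pwDl; first by have [j ->] := order_stat_mem x V_gt0; rewrite subr0.
apply: sumr_ge0 => i _; rewrite subr_ge0 order_stat_step_ge0 // => j.
exact: ltW.
Qed.

Lemma order_stat_raise x e i : (i < #|V|)%N ->
  order_stat (raise_entries x e) i.+1 = order_stat x i.+1 + e.
Proof.
move=> iV; rewrite /order_stat /=.
have -> : [seq raise_entries x e j | j <- enum V]
          = map (+%R^~ e) [seq x j | j <- enum V].
  by rewrite -[RHS]map_comp; apply/eq_map => j; rewrite /= ffunE.
rewrite -(map_sort (leT' := <=%R)); last by move=> a b; rewrite lerD2r.
by rewrite (nth_map 0) ?size_sort_values.
Qed.

Lemma upper_level_raise x e i : (i <= #|V|)%N ->
  upper_level (raise_entries x e) i = upper_level x i.
Proof.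
case: i => [//|i] iV; apply/setP => j.
by rewrite !inE order_stat_raise // ffunE ltrD2r.
Qed.

(** Raising all entries by e thickens the bottom layer, whose level set is V,
    and moves the other layers without changing them. *)
Lemma level_weight_raise x e C : (0 < #|V|)%N ->
  level_weight (raise_entries x e) C
  = level_weight x C + (C == [set: V]%SET)%:R * e.
Proof.
move=> V_gt0; rewrite /level_weight !(big_mkcond (fun i => _ == C)).
rewrite !(bigD1 (Ordinal V_gt0) (P := xpredT)) //= [RHS]addrAC.
congr (_ + _); last first.
  apply: eq_bigr => i; rewrite upper_level_raise ?(ltnW (ltn_ord i)) //.
  case: i => [[|i] iV] // _; rewrite !order_stat_raise // 1?ltnW //.
  by rewrite opprD addrACA subrr addr0.
rewrite order_stat_raise // [_ == C]eq_sym.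
by case: eqP => _; rewrite /order_stat /= ?mul1r ?subr0 ?mul0r ?addr0.
Qed.

Lemma order_stat_indicator A i :
  order_stat (@indicator R V A) i = ((#|~: A| < i) && (i <= #|V|))%N%:R.
Proof.
rewrite /order_stat.
have -> : sort <=%R [seq @indicator R V A j | j <- enum V]
          = nseq #|~: A| 0 ++ nseq #|A| 1.
  apply: (sorted_eq le_trans le_anti).
  - by apply: sort_sorted; exact: le_total.
  - rewrite sorted_pairwise; last exact: le_trans.
    rewrite pairwise_cat; apply/and3P; split.
    + by apply/allrelP => a b /nseqP[-> _] /nseqP[-> _]; exact: ler01.
    + by elim: #|~: A| => //= n ->; rewrite andbT; apply/allP => a /nseqP[->].
    + by elim: #|A| => //= n ->; rewrite andbT; apply/allP => a /nseqP[->].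
  - have permV : perm_eq (enum V) (enum (~: A) ++ enum A).
      apply: uniq_perm; rewrite ?cat_uniq ?enum_uniq ?andbT //=.
        by apply/hasPn => j; rewrite !mem_enum inE negbK.
      by move=> j; rewrite mem_cat !mem_enum !inE orNb.
    have map_enum_const (B : {set V}) (a : R) :
        {in B, forall j, indicator A j = a} ->
        [seq @indicator R V A j | j <- enum B] = nseq #|B| a.
      move=> Ba; rewrite cardE -(size_map (@indicator R V A)).
      apply/all_pred1P/allP => _ /mapP[j + ->] /=.
      by rewrite mem_enum => /Ba ->.
    rewrite perm_sort (perm_trans (perm_map _ permV)) // map_cat.
    rewrite (map_enum_const (~: A) 0) ?(map_enum_const A 1) // => j.
      by rewrite ffunE => ->.
    by rewrite inE ffunE => /negbTE ->.
case: i => [|i] //=; rewrite nth_cat !nth_nseq size_nseq ltnS.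
have cardV := cardsC A.
case: ltnP => iA //; rewrite andTb -cardV ltn_subLR // addnC.
by case: ifP.
Qed.

(** The ordered entries of an indicator vector jump once, by 1, and the level
    set just below the jump is A: the vector has a single layer. *)
Lemma level_weight_indicator A C : A != finset.set0 ->
  level_weight (indicator A) C = (A == C)%:R.
Proof.
move=> A_neq0; have cardV := cardsC A.
have zV : (#|~: A| < #|V|)%N.
  by rewrite -cardV -[ltnLHS]add0n ltn_add2r card_gt0.
rewrite /level_weight big_mkcond (bigD1 (Ordinal zV)) //= big1 ?addr0.
  rewrite !order_stat_indicator ltnn ltnS leqnn zV subr0.
  suff -> : upper_level (@indicator R V A) #|~: A| = A by case: eqP.
  rewrite /upper_level; case E: #|~: A| => [|z].
    by apply/esym; rewrite -[LHS]finset.setCK (cards0_eq E) finset.setC0.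
  apply/setP => j; rewrite inE -E order_stat_indicator ltnn ffunE.
  by case: (j \in A); rewrite ?ltr01 ?ltxx.
move=> i; rewrite -val_eqE /= => iz; case: ifP => // _.
rewrite !order_stat_indicator ltn_ord (ltnW (ltn_ord i)) !andbT ltnS.
by rewrite [(_ <= i)%N]leq_eqVlt eq_sym (negbTE iz) subrr.
Qed.

End LevelWeight.

(** * The multilinear extension as an integral over tuples of level sets *)

Section Extension.
Context {R : realType} {V : finType}.

Definition tuple_weight {N} (x : N.-tuple {ffun V -> R})
    (C : N.-tuple {set V}) : R :=
  \prod_(s < N) level_weight (tnth x s) (tnth C s).

(** Grouping the indices by the level sets they select turns the sum over
    ranks into a sum over tuples of sets, where the weights no longer depend
    on h; positivity, linearity and the product structure become visible. *)
Lemma multilinear_extE {N} (h : N.-tuple {set V} -> R) x :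
  multilinear_ext h x =
  \sum_(C : N.-tuple {set V} | nonempties C) tuple_weight x C * h C.
Proof.
pose lev (i : {ffun 'I_N -> 'I_#|V|}) :=
  [tuple upper_level (tnth x s) (i s) | s < N].
rewrite /multilinear_ext (partition_big lev xpredT) //= [RHS]big_mkcond.
apply: eq_bigr => C _; transitivity (\sum_(i | lev i == C)
    (\prod_(s < N) (order_stat (tnth x s) (i s).+1
       - order_stat (tnth x s) (i s))) * (if nonempties C then h C else 0)).
  by apply: eq_bigr => i /eqP <-.
rewrite -mulr_suml; case: ifP => _; last by rewrite mulr0.
rewrite /tuple_weight /level_weight bigA_distr_big_dep; congr (_ * _).
apply: eq_bigl => i; apply/eqP/familyP => [<- s | levi].
  by rewrite unfold_in tnth_mktuple.
apply: eq_from_tnth => s; rewrite tnth_mktuple.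
by have := levi s; rewrite unfold_in => /eqP.
Qed.

Lemma multilinear_extB {N} (h h' : N.-tuple {set V} -> R) c x :
  multilinear_ext (fun C => h C - c * h' C) x
  = multilinear_ext h x - c * multilinear_ext h' x.
Proof.
rewrite !multilinear_extE mulr_sumr -sumrB; apply: eq_bigr => C _.
by rewrite mulrBr mulrCA.
Qed.

Lemma multilinear_extN {N} (h : N.-tuple {set V} -> R) x :
  multilinear_ext (fun C => - h C) x = - multilinear_ext h x.
Proof.
by rewrite !multilinear_extE -sumrN; apply: eq_bigr => C _; rewrite mulrN.
Qed.

Lemma tuple_weight_ge0 {N} (x : N.-tuple {ffun V -> R}) C :
  pos_vectors x -> 0 <= tuple_weight x C.
Proof.
move=> x_gt0; apply: prodr_ge0 => s _.
by apply: level_weight_ge0 => j; exact: ltW.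
Qed.

Lemma multilinear_ext_ge0 {N} (h : N.-tuple {set V} -> R) x :
  (forall C, nonempties C -> 0 <= h C) -> pos_vectors x ->
  0 <= multilinear_ext h x.
Proof.
move=> h_ge0 x_gt0; rewrite multilinear_extE; apply: sumr_ge0 => C C_ne.
by rewrite mulr_ge0 ?tuple_weight_ge0 ?h_ge0.
Qed.

(** Strictness comes from the tuple (V, ..., V), which has positive weight at
    every positive x. *)
Lemma multilinear_ext_gt0 {N} (h : N.-tuple {set V} -> R) x :
  (0 < #|V|)%N -> (forall C, nonempties C -> 0 < h C) -> pos_vectors x ->
  0 < multilinear_ext h x.
Proof.
move=> V_gt0 h_gt0 x_gt0; rewrite multilinear_extE.
have T_ne : nonempties [tuple [set: V]%SET | s < N].
  by apply/forallP => s; rewrite tnth_mktuple -card_gt0 cardsT.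
rewrite (bigD1 _ T_ne) /=; apply: ltr_pwDl.
  rewrite mulr_gt0 ?h_gt0 // prodr_gt0 // => s _.
  by rewrite tnth_mktuple level_weightT_gt0.
apply: sumr_ge0 => C /andP[C_ne _].
by rewrite mulr_ge0 ?tuple_weight_ge0 ?ltW ?h_gt0.
Qed.

Lemma multilinear_ext_indicators {N} (h : N.-tuple {set V} -> R)
    (A : N.-tuple {set V}) :
  nonempties A -> multilinear_ext h (indicators A) = h A.
Proof.
move=> A_ne; have Asne s : tnth A s != finset.set0 by exact: (forallP A_ne).
rewrite multilinear_extE (bigD1 A) //= big1 ?addr0 => [|C /andP[_ CA]].
  rewrite /tuple_weight big1 ?mul1r // => s _.
  by rewrite tnth_mktuple level_weight_indicator // eqxx.
have [s sCA] : exists s, tnth A s != tnth C s.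
  apply/existsP; apply: contraNT CA; rewrite negb_exists => /forallP AC.
  by apply/eqP/eq_from_tnth => s; have := AC s; rewrite negbK => /eqP.
rewrite /tuple_weight (bigD1 s) //= tnth_mktuple level_weight_indicator //.
by rewrite (negbTE sCA) !mul0r.
Qed.

Lemma nonempties_cat k l (A : k.-tuple {set V}) (B : l.-tuple {set V}) :
  nonempties (cat_tuple A B) = nonempties A && nonempties B.
Proof.
apply/forallP/andP => [AB | [/forallP A_ne /forallP B_ne] s].
  split; apply/forallP => s.
    by have := AB (lshift l s); rewrite tnth_lshift.
  by have := AB (rshift k s); rewrite tnth_rshift.
by case: (split_ordP s) => j ->; rewrite ?tnth_lshift ?tnth_rshift.
Qed.

Lemma tuple_weight_cat k l (x : k.-tuple {ffun V -> R})
    (y : l.-tuple {ffun V -> R}) A B :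
  tuple_weight (cat_tuple x y) (cat_tuple A B)
  = tuple_weight x A * tuple_weight y B.
Proof.
rewrite /tuple_weight big_split_ord /=.
by congr (_ * _); apply: eq_bigr => s _; rewrite ?tnth_lshift ?tnth_rshift.
Qed.

(** Fubini: the weights of a concatenation are products, so extending in all
    arguments at once is extending in the second block, then in the first. *)
Lemma multilinear_ext_cat k l (h : (k + l).-tuple {set V} -> R) x y :
  multilinear_ext h (cat_tuple x y)
  = multilinear_ext (fun A =>
      multilinear_ext (fun B => h (cat_tuple A B)) y) x.
Proof.
rewrite !multilinear_extE; under [RHS]eq_bigr do
  rewrite multilinear_extE mulr_sumr.
rewrite pair_big_dep /=.
pose join (AB : k.-tuple {set V} * l.-tuple {set V}) := cat_tuple AB.1 AB.2.
have join_bij : bijective join.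
  exists (fun C : (k + l).-tuple {set V} =>
    ([tuple tnth C (lshift l s) | s < k], [tuple tnth C (rshift k s) | s < l])).
    move=> [A B]; congr pair; apply: eq_from_tnth => s;
      by rewrite tnth_mktuple ?tnth_lshift ?tnth_rshift.
  move=> C; apply: eq_from_tnth => s.
  by case: (split_ordP s) => j ->;
    rewrite ?tnth_lshift ?tnth_rshift tnth_mktuple.
rewrite (reindex join) /=; last exact: onW_bij.
apply: eq_big => [[A B] | [A B] _]; first by rewrite /= nonempties_cat.
by rewrite tuple_weight_cat mulrA.
Qed.

Lemma multilinear_ext_catC k l (h : (k + l).-tuple {set V} -> R) x y :
  multilinear_ext h (cat_tuple x y)
  = multilinear_ext (fun B =>
      multilinear_ext (fun A => h (cat_tuple A B)) x) y.
Proof.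
rewrite multilinear_ext_cat multilinear_extE.
under eq_bigr do rewrite multilinear_extE mulr_sumr.
rewrite exchange_big /= multilinear_extE; apply: eq_bigr => B _.
by rewrite multilinear_extE mulr_sumr; apply: eq_bigr => A _; rewrite mulrCA.
Qed.

Definition raised {N} (A : N.-tuple {set V}) (e : R) :
  N.-tuple {ffun V -> R} :=
  [tuple raise_entries (indicator (tnth A s)) e | s < N].

Lemma pos_vectors_raised {N} (A : N.-tuple {set V}) e :
  0 < e -> pos_vectors (raised A e).
Proof.
by move=> e_gt0 s j; rewrite tnth_mktuple !ffunE ltr_wpDl ?ler0n.
Qed.

(** The indicator vector of A lies outside the open orthant, but the positive
    vectors 1_A + e tend to it, and the weights at them are polynomial in e:
    strict positivity of h at A survives for small e. The index i allows a
    choice of e that serves finitely many functions at once. *)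
Lemma multilinear_ext_raised_gt0 {N} (I : finType) (P : pred I)
    (h : I -> N.-tuple {set V} -> R) (A : N.-tuple {set V}) :
  (0 < #|V|)%N -> nonempties A -> (forall i, P i -> 0 < h i A) ->
  exists2 x, pos_vectors x & forall i, P i -> 0 < multilinear_ext (h i) x.
Proof.
move=> V_gt0 A_ne hA_gt0.
have Asne s : tnth A s != finset.set0 by exact: (forallP A_ne).
pose p i : {poly R} := \sum_(C : N.-tuple {set V} | nonempties C)
  (\prod_(s < N) ((tnth A s == tnth C s)%:R%:P
                  + (tnth C s == [set: V]%SET)%:R *: 'X)) * (h i C)%:P.
have pE i e : (p i).[e] = multilinear_ext (h i) (raised A e).
  rewrite multilinear_extE horner_sum; apply: eq_bigr => C _.
  rewrite hornerM hornerC horner_prod; congr (_ * _).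
  apply: eq_bigr => s _; rewrite tnth_mktuple level_weight_raise //.
  by rewrite level_weight_indicator // hornerD hornerZ hornerC hornerX.
have p0 i : (p i).[0] = h i A.
  rewrite -(multilinear_ext_indicators (h i) A_ne) pE; congr multilinear_ext.
  apply: eq_from_tnth => s; rewrite !tnth_mktuple.
  by apply/ffunP => j; rewrite ffunE addr0.
have near_gt0 : \forall e \near 0^'+, forall i, P i -> 0 < (p i).[e].
  apply: filter_forall => i; case Pi : (P i); last exact: nearW.
  have p_cvg : (p i).[e] @[e --> 0^'+] --> h i A.
    by rewrite -p0; apply: cvg_at_right_filter; exact: continuous_horner.
  by apply: filterS (cvgr_gt _ p_cvg _ (hA_gt0 _ Pi)) => e pe _.
have [e [e_gt0 pe]] : exists e : R, 0 < e /\ forall i, P i -> 0 < (p i).[e].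
  near (0 : R)^'+ => e; exists e; split; near: e => //.
  exact: nbhs_right_gt.
exists (raised A e); first exact: pos_vectors_raised.
by move=> i /pe; rewrite pE.
Unshelve. all: by end_near.
Qed.

End Extension.

(** * Quotients of multilinear extensions *)

Section Quotient.
Context {R : realType} {k l : nat}.

Lemma lt_quotient T (F G : (k + l).-tuple T -> R) c a b :
  0 < G (cat_tuple a b) ->
  (c < quotient F G a b) = (0 < F (cat_tuple a b) - c * G (cat_tuple a b)).
Proof. by move=> G_gt0; rewrite /quotient ltr_pdivlMr // subr_gt0. Qed.

Lemma quotient_lt T (F G : (k + l).-tuple T -> R) c a b :
  0 < G (cat_tuple a b) ->
  (quotient F G a b < c) = (0 < - (F (cat_tuple a b) - c * G (cat_tuple a b))).
Proof.
by move=> G_gt0; rewrite /quotient ltr_pdivrMr // opprB subr_gt0.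
Qed.

Context {V : finType} (V_gt0 : (0 < #|V|)%N).
Context (f g : (k + l).-tuple {set V} -> R).
Context (g_gt0 : forall C, nonempties C -> 0 < g C).

Local Notation fM := (multilinear_ext f).
Local Notation gM := (multilinear_ext g).
Local Notation D c := (fun C => f C - c * g C).

Let g_cat_gt0 A B : nonempties A -> nonempties B -> 0 < g (cat_tuple A B).
Proof. by move=> A_ne B_ne; rewrite g_gt0 // nonempties_cat A_ne. Qed.

Let gM_gt0 x y : pos_vectors x -> pos_vectors y -> 0 < gM (cat_tuple x y).
Proof.
move=> x_gt0 y_gt0; rewrite multilinear_ext_cat.
by do 2!apply: multilinear_ext_gt0 => // ? ?; exact: g_cat_gt0.
Qed.

Lemma multilinear_ext_cat_indicatorsr (h : (k + l).-tuple {set V} -> R) x B :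
  nonempties B -> multilinear_ext h (cat_tuple x (indicators B))
                  = multilinear_ext (fun A => h (cat_tuple A B)) x.
Proof.
by move=> B_ne; rewrite multilinear_ext_catC multilinear_ext_indicators.
Qed.

Lemma multilinear_ext_cat_indicatorsl (h : (k + l).-tuple {set V} -> R) A y :
  nonempties A -> multilinear_ext h (cat_tuple (indicators A) y)
                  = multilinear_ext (fun B => h (cat_tuple A B)) y.
Proof.
by move=> A_ne; rewrite multilinear_ext_cat multilinear_ext_indicators.
Qed.

Let gM_indicatorsr_gt0 x B :
  pos_vectors x -> nonempties B -> 0 < gM (cat_tuple x (indicators B)).
Proof.
move=> x_gt0 B_ne; rewrite multilinear_ext_cat_indicatorsr //.
by apply: multilinear_ext_gt0 => // A A_ne; exact: g_cat_gt0.
Qed.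

Let gM_indicatorsl_gt0 A y :
  nonempties A -> pos_vectors y -> 0 < gM (cat_tuple (indicators A) y).
Proof.
move=> A_ne y_gt0; rewrite multilinear_ext_cat_indicatorsl //.
by apply: multilinear_ext_gt0 => // B B_ne; exact: g_cat_gt0.
Qed.

Lemma quotient_indicators A B : nonempties A -> nonempties B ->
  quotient fM gM (indicators A) (indicators B) = quotient f g A B.
Proof.
move=> A_ne B_ne.
rewrite /quotient !multilinear_ext_cat_indicatorsr //.
by rewrite !multilinear_ext_indicators.
Qed.

(** A first-block tuple A that beats c strictly against every B still does so
    after a small perturbation of its indicator vectors into the open orthant;
    averaging over the level sets of y carries this from sets to vectors. *)
Lemma lt_quotient_ext A c : nonempties A ->
  (forall B, nonempties B -> c < quotient f g A B) ->
  exists2 x, pos_vectors x &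
    forall y, pos_vectors y -> c < quotient fM gM x y.
Proof.
move=> A_ne cA.
have [|x x_gt0 xP] := multilinear_ext_raised_gt0 (P := @nonempties V l)
  (h := fun B A' => D c (cat_tuple A' B)) V_gt0 A_ne.
  by move=> B B_ne; rewrite -lt_quotient ?cA ?g_cat_gt0.
exists x => // y y_gt0; rewrite lt_quotient ?gM_gt0 //.
by rewrite -multilinear_extB multilinear_ext_catC multilinear_ext_gt0.
Qed.

Lemma quotient_ext_lt B c : nonempties B ->
  (forall A, nonempties A -> quotient f g A B < c) ->
  exists2 y, pos_vectors y &
    forall x, pos_vectors x -> quotient fM gM x y < c.
Proof.
move=> B_ne cB.
have [|y y_gt0 yP] := multilinear_ext_raised_gt0 (P := @nonempties V k)
  (h := fun A B' => - D c (cat_tuple A B')) V_gt0 B_ne.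
  by move=> A A_ne; rewrite -quotient_lt ?cB ?g_cat_gt0.
exists y => // x x_gt0; rewrite quotient_lt ?gM_gt0 //.
by rewrite -multilinear_extB -multilinear_extN multilinear_ext_cat
  multilinear_ext_gt0.
Qed.

(** Against a fixed indicator vector the competitors may range over positive
    vectors or over nonempty sets: a vector averages sets, and the indicator
    vector of a set is a limit of positive vectors. *)
Lemma quotient_le_indicatorsr B c : nonempties B ->
  (forall A, nonempties A -> quotient f g A B <= c) <->
  (forall x, pos_vectors x -> quotient fM gM x (indicators B) <= c).
Proof.
move=> B_ne; split=> [fg_le x x_gt0 | fgM_le A A_ne].
  rewrite leNgt lt_quotient ?gM_indicatorsr_gt0 // -leNgt -oppr_ge0.
  rewrite -multilinear_extB -multilinear_extN.
  rewrite multilinear_ext_cat_indicatorsr //.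
  apply: multilinear_ext_ge0 => // A A_ne.
  by rewrite oppr_ge0 leNgt -lt_quotient ?g_cat_gt0 // -leNgt fg_le.
rewrite leNgt; apply/negP => c_lt.
have [|x x_gt0 /(_ tt isT)] := multilinear_ext_raised_gt0 (P := @predT unit)
  (h := fun _ A' => D c (cat_tuple A' B)) V_gt0 A_ne.
  by move=> _ _; rewrite -lt_quotient ?g_cat_gt0.
rewrite -(multilinear_ext_cat_indicatorsr (D c)) // multilinear_extB.
by rewrite -lt_quotient ?gM_indicatorsr_gt0 // ltNge fgM_le.
Qed.

Lemma quotient_ge_indicatorsl A c : nonempties A ->
  (forall B, nonempties B -> c <= quotient f g A B) <->
  (forall y, pos_vectors y -> c <= quotient fM gM (indicators A) y).
Proof.
move=> A_ne; split=> [fg_ge y y_gt0 | fgM_ge B B_ne].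
  rewrite leNgt quotient_lt ?gM_indicatorsl_gt0 // -leNgt oppr_le0.
  rewrite -multilinear_extB multilinear_ext_cat_indicatorsl //.
  apply: multilinear_ext_ge0 => // B B_ne.
  by rewrite -oppr_le0 leNgt -quotient_lt ?g_cat_gt0 // -leNgt fg_ge.
rewrite leNgt; apply/negP => lt_c.
have [|y y_gt0 /(_ tt isT)] := multilinear_ext_raised_gt0 (P := @predT unit)
  (h := fun _ B' => - D c (cat_tuple A B')) V_gt0 B_ne.
  by move=> _ _; rewrite -quotient_lt ?g_cat_gt0.
rewrite multilinear_extN -(multilinear_ext_cat_indicatorsl (D c)) //.
rewrite multilinear_extB -quotient_lt ?gM_indicatorsl_gt0 //.
by rewrite ltNge fgM_ge.
Qed.

End Quotient.

(** * Minimax over finite sets and over orthants *)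

Lemma le_supinf_infsup (R : realType) (S T : Type) (P : set S) (Q : set T)
    (q : S -> T -> \bar R) :
  (ereal_sup [set ereal_inf [set q x y | y in Q] | x in P]
   <= ereal_inf [set ereal_sup [set q x y | x in P] | y in Q])%E.
Proof.
apply: ge_ereal_sup => _ [x Px <-]; apply: le_ereal_inf_tmp => _ [y Qy <-].
apply: (@le_trans _ _ (q x y)).
  by apply: ereal_inf_lbound; exists y.
by apply: ereal_sup_ubound; exists x.
Qed.

(** A maximin i and a minimax j form a saddle point: q i j is at most the
    min-max, by the choice of j, and at least the max-min, by the choice of i,
    and these two values are equal. *)
Lemma bigmin_bigmax_saddle (R : realType) (I J : finType) (P : pred I)
    (Q : pred J) (q : I -> J -> R) i0 j0 : P i0 -> Q j0 ->
  \big[mine/+oo%E]_(j | Q j) \big[maxe/-oo%E]_(i | P i) (q i j)%:E =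
  \big[maxe/-oo%E]_(i | P i) \big[mine/+oo%E]_(j | Q j) (q i j)%:E ->
  exists i j, [/\ P i, Q j,
    \big[mine/+oo%E]_(j | Q j) \big[maxe/-oo%E]_(i | P i) (q i j)%:E
      = (q i j)%:E,
    forall i', P i' -> q i' j <= q i j &
    forall j', Q j' -> q i j <= q i j'].
Proof.
move=> Pi0 Qj0 minmaxE.
have [i Pi maxE] := eq_bigmax i0 P
  (fun i => \big[mine/+oo%E]_(j | Q j) (q i j)%:E) Pi0
  (fun i _ => leNye _).
have [j Qj minE] := eq_bigmin j0 Q
  (fun j => \big[maxe/-oo%E]_(i | P i) (q i j)%:E) Qj0
  (fun j _ => leey _).
have le_min i' : P i' ->
    ((q i' j)%:E <= \big[mine/+oo%E]_(j | Q j)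
                     \big[maxe/-oo%E]_(i | P i) (q i j)%:E)%E.
  by rewrite minE => Pi'; exact: (le_bigmax_cond _ (fun i => (q i j)%:E)).
have ge_min j' : Q j' ->
    (\big[mine/+oo%E]_(j | Q j) \big[maxe/-oo%E]_(i | P i) (q i j)%:E
     <= (q i j')%:E)%E.
  rewrite minmaxE maxE => Qj'.
  exact: (bigmin_le_cond _ (fun j => (q i j)%:E)).
have valE : \big[mine/+oo%E]_(j | Q j) \big[maxe/-oo%E]_(i | P i) (q i j)%:E
            = (q i j)%:E.
  by apply/le_anti; rewrite ge_min ?le_min.
exists i, j; split=> // [i' Pi' | j' Qj'].
  by rewrite -lee_fin -valE le_min.
by rewrite -lee_fin -valE ge_min.
Qed.

Theorem theorem1p2 (R : realType) (V : finType) (k l : nat)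
    (k_gt0 : (0 < k)%N) (l_gt0 : (0 < l)%N)
    (f g : (k + l).-tuple {set V} -> R)
    (g_gt0 : forall A : (k + l).-tuple {set V}, nonempties A -> 0 < g A)
    (minmax_eq_maxmin :
       \big[mine/+oo%E]_(B : l.-tuple {set V} | nonempties B)
         \big[maxe/-oo%E]_(A : k.-tuple {set V} | nonempties A)
           (quotient f g A B)%:E =
       \big[maxe/-oo%E]_(A : k.-tuple {set V} | nonempties A)
         \big[mine/+oo%E]_(B : l.-tuple {set V} | nonempties B)
           (quotient f g A B)%:E) :
  let fM := multilinear_ext f in
  let gM := multilinear_ext g in
  let infsup :=
    ereal_inf [set ereal_sup [set (quotient fM gM x y)%:E
                             | x in @pos_vectors R V k]
              | y in @pos_vectors R V l] in
  let supinf :=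
    ereal_sup [set ereal_inf [set (quotient fM gM x y)%:E
                             | y in @pos_vectors R V l]
              | x in @pos_vectors R V k] in
  [/\ infsup = supinf,
      infsup = \big[mine/+oo%E]_(B : l.-tuple {set V} | nonempties B)
                 \big[maxe/-oo%E]_(A : k.-tuple {set V} | nonempties A)
                   (quotient f g A B)%:E &
      forall (As : k.-tuple {set V}) (Bs : l.-tuple {set V}),
        nonempties As -> nonempties Bs ->
        (saddle_point nonempties nonempties f g As Bs <->
         saddle_point pos_vectors pos_vectors fM gM
           (indicators As) (indicators Bs))].
Proof.
move=> fM gM infsup supinf.
have [V0 | V_gt0] := posnP #|V|.
  (* Without nonempty sets the finite min-max is +oo and the max-min is -oo. *)
  have none N : (0 < N)%N -> @nonempties V N =1 xpred0.
    case: N => // N _ A; apply/negbTE; rewrite negb_forall; apply/existsP.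
    by exists ord0; rewrite negbK -cards_eq0 -leqn0 -V0 max_card.
  by move: minmax_eq_maxmin; rewrite !big_pred0 //; exact: none.
have T_ne N : nonempties [tuple [set: V]%SET | s < N].
  by apply/forallP => s; rewrite tnth_mktuple -card_gt0 cardsT.
have [A [B [A_ne B_ne valE leAB geAB]]] :=
  bigmin_bigmax_saddle (T_ne k) (T_ne l) minmax_eq_maxmin.
have le_supinf : ((quotient f g A B)%:E <= supinf)%E.
  apply/lee_subgt0Pr => e e_gt0.
  have [|x x_gt0 xP] :=
    lt_quotient_ext (f := f) (c := quotient f g A B - e) V_gt0 g_gt0 A_ne.
    by move=> B' /geAB; apply: lt_le_trans; rewrite ltrBlDr ltrDl.
  apply: le_trans (ereal_sup_ubound _); last by exists x.
  by apply: le_ereal_inf_tmp => _ [y /xP /ltW y_le <-]; rewrite lee_fin.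
have infsup_le : (infsup <= (quotient f g A B)%:E)%E.
  apply/lee_addgt0Pr => e e_gt0.
  have [|y y_gt0 yP] :=
    quotient_ext_lt (f := f) (c := quotient f g A B + e) V_gt0 g_gt0 B_ne.
    by move=> A' /leAB; move/le_lt_trans; apply; rewrite ltrDl.
  apply: le_trans (ereal_inf_lbound _) _; first by exists y.
  by apply: ge_ereal_sup => _ [x /yP /ltW x_le <-]; rewrite lee_fin.
have weak : (supinf <= infsup)%E by exact: le_supinf_infsup.
split=> [||As Bs As_ne Bs_ne].
- by apply/le_anti; rewrite weak (le_trans infsup_le).
- by rewrite valE; apply/le_anti; rewrite infsup_le (le_trans le_supinf).
rewrite /saddle_point quotient_indicators //.
have leP := quotient_le_indicatorsr V_gt0 f g_gt0 (quotient f g As Bs) Bs_ne.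
have geP := quotient_ge_indicatorsl V_gt0 f g_gt0 (quotient f g As Bs) As_ne.
by split=> -[/leP le_ /geP ge_].
Qed.
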